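(* For every $n,\lambda\in\mathbb{N}$ and each $\mu\in\{0,\dots,\lambda\}$, we have $$OP_{\Gamma_n,\operatorname{Rot}(\Gamma_n)}(\lambda,\mu)=\frac1n\sum_{d\mid n}\varphi\!\left(\frac nd\right)V_d(\lambda-1,\mu-\lambda)\,-\,\mu+1$$ if $n$ is odd, and $$OP_{\Gamma_n,\operatorname{Rot}(\Gamma_n)}(\lambda,\mu)=\frac1n\sum_{d\mid n}\varphi\!\left(\frac nd\right)V_d(\lambda-1,\mu-\lambda)$$ if $n$ is even.
   Context: $\mathbb{N}$ denotes the positive integers. For $n\ge1$, $\Gamma_n$ is the cycle of length $n$, with vertex set $\{0,\dots,n-1\}$ and edges $\{v,(v+1)\bmod n\}$ for $v=0,\dots,n-1$; thus $\Gamma_1$ is a single vertex with a loop, and $\Gamma_2$ consists of two vertices joined by two parallel edges. $\operatorname{Rot}(\Gamma_n)=\{r_0,\dots,r_{n-1}\}$ is the group of rotations, where $r_m(v)=(v+m)\bmod n$. A $\lambda$-coloring of a graph $\Gamma$ is a map $f$ from its vertex set to $\{1,\dots,\lambda\}$; it is $\mu$-proper if for every pair of adjacent vertices $v,w$, either $f(v)\ne f(w)$ or $f(v)=f(w)>\mu$ (a vertex with a loop is adjacent to itself, so it must get a color $>\mu$). For a subgroup $G$ of the automorphism group of $\Gamma$ (viewed as permutations of the vertices), $OP_{\Gamma,G}(\lambda,\mu)$ is the number of equivalence classes of $\mu$-proper $\lambda$-colorings of $\Gamma$, where $f$ and $f'$ are equivalent if $f'=f\circ g$ for some $g\in G$.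 $\varphi$ is Euler's totient function, and the sums run over the positive divisors $d$ of $n$. For integers $P,Q$, the Lucas sequence of the second kind is defined by $V_0(P,Q)=2$, $V_1(P,Q)=P$, and $V_n(P,Q)=P\,V_{n-1}(P,Q)-Q\,V_{n-2}(P,Q)$ for $n>1$. *)

(* Defs.v *)
From mathcomp Require Import all_boot all_order all_algebra all_fingroup.

Set Implicit Arguments.
Unset Strict Implicit.
Unset Printing Implicit Defensive.

(* Undirected multigraphs with loops: each edge comes with its two endpoints,
   listed in an arbitrary order. *)
Record mgraph := MGraph {
  vertex : finType;
  edge : finType;
  ends : edge -> vertex * vertex
}.

Section Graphs.

Variable Gamma : mgraph.

Definition joins (e : edge Gamma) (v w : vertex Gamma) : bool :=
  (ends e == (v, w)) || (ends e == (w, v)).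

Definition adj (v w : vertex Gamma) : bool := [exists e, joins e v w].

Definition autom : {set {perm vertex Gamma}} :=
  [set g : {perm vertex Gamma} | [forall v, forall w,
     #|[set e | joins e (g v) (g w)]| == #|[set e | joins e v w]|]].

(* The colors 1, ..., lambda are encoded by 'I_lambda: c stands for c.+1. *)
Definition color (lambda : nat) (c : 'I_lambda) : nat := c.+1.

Definition coloring (lambda : nat) := {ffun vertex Gamma -> 'I_lambda}.

Definition proper_coloring (lambda mu : nat) (f : coloring lambda) : bool :=
  [forall v, forall w,
     adj v w ==> (f v != f w) || (f v == f w) && (mu < color (f v))].

Definition col_equiv (lambda : nat) (G : {group {perm vertex Gamma}})
    (f f' : coloring lambda) : bool :=
  [exists g in G, f' == [ffun v => f (g v)]].

Definition OP (G : {group {perm vertex Gamma}}) (lambda mu : nat) : nat :=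
  #|equivalence_partition (@col_equiv lambda G)
      [set f : coloring lambda | proper_coloring mu f]|.

Lemma autom_group_set : group_set autom.
Proof.
apply/group_setP; split.
  by rewrite inE; apply/forallP=> v; apply/forallP=> w; rewrite !perm1.
move=> g h; rewrite !inE => /forallP Hg /forallP Hh.
apply/forallP=> v; apply/forallP=> w; rewrite !permM.
by rewrite (eqP (forallP (Hh _) _)) (eqP (forallP (Hg _) _)).
Qed.

Canonical autom_group := Group autom_group_set.

Lemma col_equiv_rel (lambda : nat) (G : {group {perm vertex Gamma}}) :
  equivalence_rel (@col_equiv lambda G).
Proof.
have sym f f' : @col_equiv lambda G f f' -> @col_equiv lambda G f' f.
  case/exists_inP=> g Gg /eqP->; apply/exists_inP.
  exists (g^-1)%g; first by rewrite groupV.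
  by apply/eqP/ffunP=> v; rewrite !ffunE permKV.
have trans f f' f'' : @col_equiv lambda G f f' -> @col_equiv lambda G f' f'' ->
    @col_equiv lambda G f f''.
  case/exists_inP=> g Gg /eqP-> /exists_inP[h Gh /eqP->]; apply/exists_inP.
  exists (h * g)%g; first by rewrite groupM.
  by apply/eqP/ffunP=> v; rewrite !ffunE permM.
move=> f f' f''; split.
  apply/exists_inP; exists 1%g => //.
  by apply/eqP/ffunP=> v; rewrite ffunE perm1.
by move=> Hf; apply/idP/idP; [apply: trans; apply: sym | apply: trans].
Qed.

End Graphs.

(* ordS v is (v + 1) mod n. *)
Definition cycle_graph (n : nat) : mgraph :=
  @MGraph 'I_n 'I_n (fun v => (v, ordS v)).

Definition rot_fun (n m : nat) (v : 'I_n) : 'I_n :=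
  Ordinal (ltn_pmod (v + m) (leq_ltn_trans (leq0n v) (ltn_ord v))).

Lemma rot_fun_inj (n m : nat) : injective (@rot_fun n m).
Proof.
move=> v w /(congr1 val)/= /eqP; rewrite eqn_modDr !modn_small // => /eqP.
exact: val_inj.
Qed.

Definition rotation (n m : nat) : {perm 'I_n} := perm (@rot_fun_inj n m).

Definition Rot_set (n : nat) : {set {perm 'I_n}} :=
  [set rotation n m | m : 'I_n].

Lemma Rot_group_set (n : nat) (n_gt0 : 0 < n) : group_set (Rot_set n).
Proof.
apply/group_setP; split.
  apply/imsetP; exists (Ordinal n_gt0) => //.
  by apply/permP=> v; apply: val_inj; rewrite perm1 permE /= addn0 modn_small.
move=> _ _ /imsetP[i _ ->] /imsetP[j _ ->]; apply/imsetP.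
exists (Ordinal (ltn_pmod (i + j) n_gt0)) => //.
apply/permP=> v; apply: val_inj; rewrite permM !permE /=.
by rewrite modnDml modnDmr addnA.
Qed.

Definition Rot (n : nat) (n_gt0 : 0 < n) : {group {perm vertex (cycle_graph n)}} :=
  Group (Rot_group_set n_gt0).

Lemma Rot_sub_autom (n : nat) (n_gt0 : 0 < n) :
  Rot n_gt0 \subset autom (cycle_graph n).
Proof.
apply/subsetP=> _ /imsetP[m _ ->]; rewrite inE.
apply/forallP=> v; apply/forallP=> w.
rewrite -(card_imset [set e | _ e v w] (@rot_fun_inj n m)).
apply/eqP/eq_card=> e.
have [e' ->] : exists e', e = rot_fun m e'.
  have [h _ hK] := injF_bij (@rot_fun_inj n m).
  by exists (h e); rewrite hK.
rewrite mem_imset; last exact: rot_fun_inj.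
have rS x : ordS (rot_fun m x) = rot_fun m (ordS x).
  by apply: val_inj; rewrite /= modnDml -addn1 modnDml addn1 addSn.
rewrite !inE /joins /= !xpair_eqE !permE rS.
by rewrite !(inj_eq (@rot_fun_inj n m)).
Qed.

Import GRing.Theory.
Local Open Scope ring_scope.

Fixpoint lucasV (P Q : int) (n : nat) : int :=
  match n with
  | 0 => 2
  | n'.+1 => match n' with
             | 0 => P
             | n''.+1 => P * lucasV P Q n' - Q * lucasV P Q n''
             end
  end.

(* Main.v *)
(** By Burnside's lemma, [n * OP] is the sum over the rotations [r_m] of the
    number of proper colorings of the [n]-cycle fixed by [r_m]; these are the
    pullbacks of the proper colorings of the cycle of length [gcd n m].  Proper
    colorings of the [k]-cycle are closed walks of length [k] in the graph on the
    colors with adjacency matrix [A = J - D], where [J] is the all-ones matrix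
    and [D] is diagonal with [mu] leading ones.  On the plane spanned by the
    all-ones vector and the diagonal of [D], which contains the image of
    [A ^ 2 + A], the matrix [A] is a root of
    [x ^ 2 - (lambda - 1) x + (mu - lambda)].  Hence
    [tr (A ^ k.+2) + tr (A ^ k.+1)] satisfies the Lucas recurrence, and
    [tr (A ^ k) = V_k + (-1) ^ k (mu - 1)] for [k > 0].  The alternating part
    contributes [-n (mu - 1)] for odd [n] and [0] for even [n]. *)

Require Import Defs.
From mathcomp Require Import all_boot all_order all_algebra all_fingroup.
From mathcomp Require Import ring.

Set Implicit Arguments.
Unset Strict Implicit.
Unset Printing Implicit Defensive.
Import GRing.Theory.
Local Open Scope ring_scope.

(** * Closed walks, traces, and proper colorings of a cycle *)

Definition adj_mx (l : nat) (e : rel 'I_l) : 'M[int]_l := \matrix_(i, j) (e i j)%:R.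

Lemma adj_mx_exp (l : nat) (e : rel 'I_l) (k : nat) (x y : 'I_l) :
  (adj_mx e ^+ k) x y =
    \sum_(t : k.-tuple 'I_l) (path e x t && (last x t == y))%:R.
Proof.
elim: k x => [|k IH] x.
  rewrite expr0 mxE (bigD1 [tuple]) //= big1 ?addr0 // => t /eqP[].
  exact: tuple0.
rewrite exprS mxE.
rewrite (reindex (fun p : 'I_l * k.-tuple 'I_l => [tuple of p.1 :: p.2])) /=; last first.
  exists (fun t => (thead t, [tuple of behead t])) => [[z t] _|t _].
    by rewrite /= theadE; congr (_, _); apply: val_inj.
  by rewrite /= -tuple_eta.
rewrite -(pair_big xpredT xpredT (fun z (t : k.-tuple 'I_l) =>
  ((e x z && path e z t) && (last z t == y))%:R)) /=.
apply: eq_bigr => z _; rewrite mxE IH big_distrr /=.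
by apply: eq_bigr => t _; rewrite -andbA -(mulnb (e x z)) natrM.
Qed.

Lemma mxtrace_adj_mx_exp (l : nat) (e : rel 'I_l) (k : nat) :
  \tr (adj_mx e ^+ k.+1) = #|[set t : k.+1.-tuple 'I_l | path.cycle e t]|%:R.
Proof.
rewrite /mxtrace; under eq_bigr do rewrite adj_mx_exp.
rewrite exchange_big /= -sum1dep_card natr_sum [RHS]big_mkcond /=.
(* For a fixed [t], the only start [x] that closes the walk is the last entry of [t]. *)
apply: eq_bigr => t _; rewrite (bigD1 (last (thead t) t)) //= big1 ?addr0.
  case/tupleP: t => a t; rewrite theadE (cycle_path a) /= eqxx andbT.
  by case: (e _ _ && _).
move=> x; case/tupleP: t => a t; rewrite theadE /= eq_sym => /negbTE ->.
by rewrite andbF.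
Qed.

Lemma cycle_tupleP (T : eqType) (e : rel T) (k : nat) (t : k.+1.-tuple T) :
  reflect (forall i, e (tnth t i) (tnth t (ordS i))) (path.cycle e t).
Proof.
case/tupleP: t => a t; rewrite [path.cycle _ _]/=.
(* [path.cycle] compares [a :: t] with its shift [rcons t a]; the wrap-around at [i = k] is the
   reduction modulo [k.+1]. *)
have E i : (i < k.+1)%N ->
    nth a (rcons t a) i = tnth [tuple of a :: t] (inord (i.+1 %% k.+1)).
  move=> ik; rewrite (tnth_nth a) inordK ?ltn_mod // nth_rcons size_tuple.
  move: ik; rewrite ltnS leq_eqVlt => /predU1P[->|ik].
    by rewrite ltnn eqxx modnn.
  by rewrite ik modn_small // ltnS.
have E0 (i : 'I_k.+1) : nth a (a :: rcons t a) i = tnth [tuple of a :: t] i.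
  by rewrite (tnth_nth a) -rcons_cons nth_rcons /= size_tuple ltn_ord.
have ES (i : 'I_k.+1) : inord (i.+1 %% k.+1) = ordS i.
  by apply: val_inj; rewrite /= inordK ?ltn_mod.
apply: (iffP (pathP a)) => H i.
  by rewrite -E0 -ES -E // H // size_rcons size_tuple.
rewrite size_rcons size_tuple => ik.
by rewrite E // (ES (Ordinal ik)) (E0 (Ordinal ik)) H.
Qed.

(* Colors are shifted by one in ['I_l], so [mu <= a] says that the color exceeds [mu]. *)
Definition compat (l mu : nat) (a b : 'I_l) : bool := (a != b) || (mu <= a)%N.

Lemma proper_cycleP (k l mu : nat) (f : coloring (cycle_graph k) l) :
  reflect (forall i : 'I_k, compat mu (f i) (f (ordS i))) (proper_coloring mu f).
Proof.
apply: (iffP forallP) => [H i|H v].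
  have /forallP/(_ (ordS i))/implyP := H i.
  rewrite /compat; case: eqVneq => //= _; apply.
  by apply/existsP; exists i; rewrite /joins /= eqxx.
apply/forallP => w; apply/implyP => /existsP[i].
rewrite /joins /= !xpair_eqE; move: (H i); rewrite /compat /color ltnS.
by case/orP=> h /orP[] /andP[/eqP <- /eqP <-]; move: h;
  rewrite ?orbF // => h; rewrite ?h // ?(eq_sym (f (ordS i))) ?h //;
  case: eqVneq => //= <-.
Qed.

Definition proper_count (k l mu : nat) : nat :=
  #|[set f : coloring (cycle_graph k) l | proper_coloring mu f]|.

(** Read around the cycle, a proper coloring is a closed walk for [compat]. For [k = 0] the loop of
    the one-vertex cycle matches a walk of length 1. *)
Lemma proper_count_trace (k l mu : nat) :
  (proper_count k.+1 l mu)%:R = \tr (adj_mx (@compat l mu) ^+ k.+1).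
Proof.
rewrite mxtrace_adj_mx_exp; congr _%:R.
pose h (t : k.+1.-tuple 'I_l) : coloring (cycle_graph k.+1) l := [ffun i => tnth t i].
have h_inj : injective h.
  move=> s t /ffunP st; apply: eq_from_tnth => i.
  by have := st i; rewrite !ffunE.
rewrite -(card_imset _ h_inj); apply: eq_card => f; rewrite inE.
have -> : f = h [tuple f i | i < k.+1].
  by apply/ffunP => i; rewrite ffunE tnth_mktuple.
rewrite mem_imset // inE; apply/proper_cycleP/cycle_tupleP => H i.
  by have := H i; rewrite !ffunE.
by rewrite !ffunE.
Qed.

Lemma lucasVSS (P Q : int) (k : nat) :
  lucasV P Q k.+2 = P * lucasV P Q k.+1 - Q * lucasV P Q k.
Proof. by []. Qed.

(** * Traces of powers of the compatibility matrix *)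

Section CompatTrace.
Variables (l mu : nat).
Hypothesis mu_le : (mu <= l)%N.

Let A := adj_mx (@compat l mu).
Let c : 'cV[int]_l := const_mx 1.
(** The diagonal of [D]. With [c] the all-ones column, [J = c *m c^T], [J *m D = c *m u^T] and
    [D *m J = u *m c^T]. *)
Let u : 'cV[int]_l := \col_i (i < mu)%N%:R.
Let L : int := l%:R.
Let M : int := mu%:R.

Lemma sum_ltn : \sum_(i < l) ((i < mu)%N%:R : int) = M.
Proof.
rewrite -natr_sum -big_mkcond /= -(big_ord_widen l (fun=> 1%N) mu_le).
by rewrite sum1_card card_ord.
Qed.

Lemma trace_cc : \tr (c *m c^T) = L.
Proof.
rewrite /mxtrace; under eq_bigr do rewrite !mxE big_ord1 !mxE mulr1.
by rewrite sumr_const card_ord.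
Qed.

Lemma trace_uc : \tr (u *m c^T) = M.
Proof.
rewrite /mxtrace; under eq_bigr do rewrite !mxE big_ord1 !mxE mulr1.
exact: sum_ltn.
Qed.

Lemma trace_cu : \tr (c *m u^T) = M.
Proof. by rewrite -mxtrace_tr trmx_mul trmxK trace_uc. Qed.

Lemma trace_uu : \tr (u *m u^T) = M.
Proof.
rewrite -sum_ltn; apply: eq_bigr => i _; rewrite !mxE big_ord1 !mxE.
by case: (_ < _)%N.
Qed.

Lemma compatE (i j : 'I_l) :
  (@compat l mu i j)%:R = 1 - (i == j)%:R * (i < mu)%N%:R :> int.
Proof.
rewrite /compat; case: eqVneq => [_|_] /=; last by rewrite mul0r subr0.
by rewrite mul1r ltnNge; case: (mu <= i)%N.
Qed.

Lemma adj_mul_col (v : 'cV[int]_l) i :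
  (A *m v) i 0 = \sum_j v j 0 - (i < mu)%N%:R * v i 0.
Proof.
rewrite mxE; under eq_bigr => j _ do rewrite mxE compatE mulrBl mul1r.
rewrite sumrB; congr (_ - _).
rewrite (bigD1 i) //= eqxx mul1r big1 ?addr0 // => j ji.
by rewrite eq_sym (negbTE ji) !mul0r.
Qed.

Lemma adj_mul_c : A *m c = L *: c - u.
Proof.
apply/matrixP => i j; rewrite ord1 adj_mul_col !mxE !mulr1; congr (_ - _).
by under eq_bigr do rewrite mxE; rewrite sumr_const card_ord.
Qed.

Lemma adj_mul_u : A *m u = M *: c - u.
Proof.
apply/matrixP => i j; rewrite ord1 adj_mul_col !mxE mulr1; congr (_ - _).
  by under eq_bigr do rewrite mxE; rewrite sum_ltn.
by case: (_ < _)%N.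
Qed.

Lemma mxtraceB (X Y : 'M[int]_l) : \tr (X - Y) = \tr X - \tr Y.
Proof. exact: raddfB. Qed.

Let B := (L + 1) *: (c *m c^T) - c *m u^T - u *m c^T.

(** Expand [A = J - D] with [J ^ 2 = L J]; since [D] is idempotent, its own terms cancel and only
    products involving [J] remain. *)
Lemma adj_sqr : A *m A + A = B.
Proof.
apply/matrixP => i j; rewrite !mxE !big_ord1 !mxE compatE.
under eq_bigr => k _.
  rewrite !mxE !compatE.
  (* Writing each Kronecker delta as a test on [k] makes the sums over [k] collapse to single terms;
     the last summand uses that [D] is idempotent. *)
  have -> : (1 - (i == k)%:R * (i < mu)%N%:R) * (1 - (k == j)%:R * (k < mu)%N%:R) =
     1 - (if k == i then (i < mu)%N%:R else 0) - (if k == j then (j < mu)%N%:R else 0)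
     + (if k == i then (i == j)%:R * (i < mu)%N%:R else 0) :> int.
    rewrite (eq_sym i k); case: (eqVneq k i) => [->|_].
      by case: (eqVneq i j) => [<-|_]; case: (_ < _)%N.
    rewrite /= mul0r !subr0 mul1r.
    by case: (eqVneq k j) => [<-|_]; rewrite ?mul1r ?mul0r ?subr0.
  over.
rewrite big_split /= !sumrB sumr_const card_ord -!big_mkcond !big_pred1_eq /L.
by ring.
Qed.

Lemma adj_mul_B : A *m B = (L + 1) *: ((L *: c - u) *m c^T)
  - (L *: c - u) *m u^T - (M *: c - u) *m c^T.
Proof. by rewrite /B !mulmxBr -scalemxAr !mulmxA adj_mul_c adj_mul_u. Qed.

(** The columns of [B] lie in the span of [c] and [u], where [A] sends [c] to [L c - u] and [u] to
    [M c - u]: trace [L - 1], determinant [M - L]. This is Cayley-Hamilton for that 2 by 2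
    action. *)
Lemma adj_annihilator : A *m (A *m B) - (L - 1) *: (A *m B) + (M - L) *: B = 0.
Proof.
rewrite adj_mul_B !mulmxBr -!scalemxAr !mulmxA !mulmxBr -!scalemxAr.
rewrite adj_mul_c adj_mul_u /B !mulmxBl -!scalemxAl !mulmxBl -!scalemxAl.
(* The identity is linear in the four outer products, so they can be treated as independent
   matrices. *)
move: (c *m c^T) (c *m u^T) (u *m c^T) (u *m u^T) => cc cu uc uu.
by apply/matrixP => i j; rewrite !mxE; ring.
Qed.

Let tr k : int := \tr (A ^+ k).

Lemma trace_exp_sum (k : nat) : tr k.+2 + tr k.+1 = \tr (A ^+ k *m B).
Proof.
rewrite /tr -mxtraceD -adj_sqr mulmxDr; congr (\tr (_ + _)).
  by rewrite 2!exprSr -mulrA.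
by rewrite exprSr.
Qed.

Lemma trace_recurrence (k : nat) :
  tr k.+4 + tr k.+3 =
    (L - 1) * (tr k.+3 + tr k.+2) - (M - L) * (tr k.+2 + tr k.+1).
Proof.
rewrite !trace_exp_sum; apply/eqP; rewrite -subr_eq0; apply/eqP.
move: adj_annihilator; generalize B => X annX.
(* The recurrence is the trace of the annihilating relation multiplied on the left by [A ^+ k]. *)
rewrite -[RHS](mxtrace0 _ l) -(mulmx0 _ (A ^+ k)) -annX.
rewrite !(mulmxDr, mulmxN) -!scalemxAr !mulmxA.
have -> : A ^+ k *m A *m A = A ^+ k.+2 by rewrite 2!exprSr.
have -> : A ^+ k *m A = A ^+ k.+1 by rewrite exprSr.
by rewrite mxtraceD mxtraceB !mxtraceZ; ring.
Qed.

(** Sums of consecutive traces agree with those of the Lucas sequence, which fixes the traces up to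
    an alternating term; [tr 1 = (L - 1) - (M - 1)] gives its size. At exponent 0 the formula would
    give [M + 1] instead of [L], so indices start at 1. *)
Lemma trace_compat (k : nat) :
  tr k.+1 = lucasV (L - 1) (M - L) k.+1 + (-1) ^+ k.+1 * (M - 1).
Proof.
have V2 := lucasVSS (L - 1) (M - L) 0; have V3 := lucasVSS (L - 1) (M - L) 1.
have E1 : tr 1 = L - M.
  rewrite /tr expr1 /mxtrace; under eq_bigr do rewrite mxE compatE eqxx mul1r.
  by rewrite sumrB sum_ltn sumr_const card_ord.
have E2 : tr 2 + tr 1 = (L + 1) * L - M *+ 2.
  rewrite trace_exp_sum expr0 mul1mx /B !mxtraceB mxtraceZ.
  by rewrite trace_cc trace_cu trace_uc; ring.
have E3 : tr 3 + tr 2 = (L + 1) * (L * L - M) - (L * M - M) - (M * L - M).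
  rewrite trace_exp_sum expr1 adj_mul_B !mulmxBl -!scalemxAl.
  rewrite !(mxtraceB, mxtraceZ).
  by rewrite trace_cc trace_cu trace_uc trace_uu.
have S : forall j, tr j.+2 + tr j.+1 =
    lucasV (L - 1) (M - L) j.+2 + lucasV (L - 1) (M - L) j.+1.
  (* Two consecutive sums are carried along, as the recurrence has order 2. *)
  move=> j; suff [] : tr j.+2 + tr j.+1 =
    lucasV (L - 1) (M - L) j.+2 + lucasV (L - 1) (M - L) j.+1 /\
    tr j.+3 + tr j.+2 =
    lucasV (L - 1) (M - L) j.+3 + lucasV (L - 1) (M - L) j.+2 by [].
  elim: j => [|j [IH1 IH2]].
    by rewrite E2 E3 V3 V2 /=; split; ring.
  split=> //; rewrite trace_recurrence IH1 IH2.
  by rewrite (lucasVSS _ _ j.+2) [in LHS](lucasVSS _ _ j.+1) (lucasVSS _ _ j.+1); ring.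
elim: k => [|k IH]; first by rewrite E1 /=; ring.
(* The alternating terms of indices [k.+2] and [k.+1] cancel. *)
by apply: (addIr (tr k.+1)); rewrite S IH (exprS _ k.+1); ring.
Qed.

End CompatTrace.

Lemma proper_countE (k l mu : nat) : (mu <= l)%N -> (0 < k)%N ->
  (proper_count k l mu)%:R =
    lucasV (l%:Z - 1) (mu%:Z - l%:Z) k + (-1) ^+ k * (mu%:Z - 1).
Proof.
by case: k => // k mu_le _; rewrite proper_count_trace trace_compat // !natz.
Qed.

(** * Grouping residues modulo [n] by their gcd with [n] *)

Lemma card_gcdn_eq (n d : nat) : (0 < n)%N -> (d %| n)%N ->
  #|[set m : 'I_n | gcdn n m == d]| = totient (n %/ d).
Proof.
move=> n_gt0 dn; have d_gt0 := dvdn_gt0 n_gt0 dn.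
have nE : n = (d * (n %/ d))%N by rewrite mulnC divnK.
have lt_n (k : 'I_(n %/ d)) : (d * k < n)%N by rewrite [X in (_ < X)%N]nE ltn_pmul2l.
(* The residues with gcd [d] are the multiples [d * k] with [k] coprime to [n %/ d]. *)
pose h k := Ordinal (lt_n k).
have h_inj : injective h.
  by move=> x y /(congr1 val) /eqP; rewrite /= eqn_pmul2l // => /eqP /val_inj.
rewrite totient_count_coprime big_mkord -big_mkcond sum1dep_card -(card_imset _ h_inj).
apply: eq_card => m; rewrite inE; apply/eqP/imsetP => [mE|[k + ->]].
  have dm : (d %| m)%N by rewrite -mE dvdn_gcdr.
  have mdE : m = (d * (m %/ d))%N :> nat by rewrite mulnC divnK.
  have lt_md : (m %/ d < n %/ d)%N by rewrite -(ltn_pmul2l d_gt0) -nE -mdE.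
  exists (Ordinal lt_md); last exact: val_inj.
  by rewrite inE /coprime -(eqn_pmul2l d_gt0) muln_gcdr /= -nE -mdE muln1 mE.
by rewrite inE /= => /eqP co; rewrite [X in gcdn X _]nE -muln_gcdr co muln1.
Qed.

(** The target is a general [nmodType] because the lemma serves both for counts in [nat] and for
    signs in [rat]. *)
Lemma sum_gcdn (V : nmodType) (n : nat) (F : nat -> V) : (0 < n)%N ->
  \sum_(m < n) F (gcdn n m) = \sum_(d <- divisors n) F d *+ totient (n %/ d).
Proof.
move=> n_gt0.
transitivity (\sum_(m < n) \sum_(d <- divisors n | d == gcdn n m) F d).
  apply: eq_bigr => m _; rewrite -big_filter filter_pred1_uniq ?divisors_uniq //.
    by rewrite big_seq1.
  by rewrite -dvdn_divisors // dvdn_gcdl.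
rewrite (exchange_big_dep xpredT) //=; apply: eq_big_seq => d.
rewrite -dvdn_divisors // => dn; rewrite -card_gcdn_eq // -sumr_const.
by apply: eq_bigl => m; rewrite inE eq_sym.
Qed.

(** * Burnside's lemma for colorings of a graph *)

Section Burnside.
Variables (Gamma : mgraph) (l : nat).

(* The inverse makes this a right action, with the same orbits as [f o g]. *)
Definition col_act (f : coloring Gamma l) (g : {perm vertex Gamma}) :
  coloring Gamma l := [ffun v => f ((g^-1)%g v)].

Lemma col_act1 : col_act^~ 1%g =1 id.
Proof. by move=> f; apply/ffunP => v; rewrite ffunE invg1 perm1. Qed.

Lemma col_actM f : act_morph col_act f.
Proof. by move=> g h; apply/ffunP => v; rewrite !ffunE invMg permM. Qed.

Definition col_action := TotalAction col_act1 col_actM.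

Lemma OP_burnside (G : {group {perm vertex Gamma}}) (mu : nat) :
  (forall g : {perm vertex Gamma}, g \in G -> forall f : coloring Gamma l,
     proper_coloring mu ([ffun v => f (g v)] : coloring Gamma l) =
     proper_coloring mu f) ->
  (OP G l mu * #|G| =
   \sum_(g in G) #|[set f : coloring Gamma l |
                     proper_coloring mu f && (f == [ffun v => f (g v)])]|)%N.
Proof.
move=> proper_inv; set S := [set f : coloring Gamma l | proper_coloring mu f].
have actS : [acts G, on S | col_action].
  apply/actsP => g Gg f; rewrite !inE /=.
  exact: (proper_inv (g^-1)%g (groupVr Gg)).
(* The equivalence classes are orbits; the inverse in [col_act] is absorbed by replacing [g] with
   its inverse. *)
transitivity (#|[set orbit col_action G f | f in S]| * #|G|)%N.
  rewrite /OP /equivalence_partition; congr (#|pred_of_set _| * _)%N.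
  apply: eq_in_imset => f Sf; apply/setP => f'.
  rewrite inE; apply/andP/orbitP => [[_ /exists_inP[g Gg /eqP ->]]|[g Gg <-]].
    exists (g^-1)%g; first by rewrite groupV.
    by apply/ffunP => v; rewrite !ffunE invgK.
  split; first by rewrite (actsP actS).
  by apply/exists_inP; exists (g^-1)%g; rewrite ?groupV.
rewrite -Frobenius_Cauchy //; apply: eq_bigr => g _; apply: eq_card => f.
rewrite !inE sub1set inE; congr (_ && _).
apply/eqP/eqP => /ffunP fE; apply/ffunP => v.
  by rewrite ffunE -[RHS]fE ffunE permK.
by rewrite ffunE fE ffunE permKV.
Qed.

End Burnside.

(** * Colorings fixed by a rotation of the cycle *)

Section CycleRotations.
Variables (n l mu : nat).
Hypothesis n_gt0 : (0 < n)%N.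

Lemma rot_fun_ordS (m : nat) (v : 'I_n) : ordS (rot_fun m v) = rot_fun m (ordS v).
Proof. by apply: val_inj; rewrite /= modnDml -addn1 modnDml addn1 addSn. Qed.

Lemma proper_rotation (m : nat) (f : coloring (cycle_graph n) l) :
  proper_coloring mu ([ffun v => f (rotation n m v)] : coloring (cycle_graph n) l) =
  proper_coloring mu f.
Proof.
apply/proper_cycleP/proper_cycleP => H i; last first.
  by rewrite !ffunE !permE -rot_fun_ordS.
have := H ((rotation n m)^-1 i)%g; rewrite !ffunE permKV.
have -> : rotation n m (ordS ((rotation n m)^-1%g i)) = ordS i => //.
by rewrite permE -rot_fun_ordS -[in RHS](permKV (rotation n m) i) [in RHS]permE.
Qed.

Lemma rotation_inj : injective (fun m : 'I_n => rotation n m).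
Proof.
move=> i j /permP/(_ (Ordinal n_gt0)); rewrite !permE => /(congr1 val) /=.
by rewrite !add0n !modn_small // => /val_inj.
Qed.

Lemma card_Rot : #|Rot n_gt0| = n.
Proof. by rewrite card_imset ?card_ord //; apply: rotation_inj. Qed.

(** A coloring fixed by the rotation has periods [m] and [n], hence [g], so it factors through
    reduction modulo [g]. That map [p] commutes with [ordS], so properness passes both ways. *)
Lemma card_fixed_rotation (m : nat) :
  #|[set f : coloring (cycle_graph n) l | proper_coloring mu f &&
      (f == [ffun v => f (rotation n m v)])]| = proper_count (gcdn n m) l mu.
Proof.
set g := gcdn n m.
have g_gt0 : (0 < g)%N by rewrite gcdn_gt0 n_gt0.
have gn : (g %| n)%N by apply: dvdn_gcdl.
have gm : (g %| m)%N by apply: dvdn_gcdr.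
have g_le : (g <= n)%N by apply: dvdn_leq.
pose p (v : 'I_n) : 'I_g := Ordinal (ltn_pmod v g_gt0).
have p_widen (w : 'I_g) : p (widen_ord g_le w) = w.
  by apply: val_inj; rewrite /= modn_small.
have p_ordS v : p (ordS v) = ordS (p v).
  by apply: val_inj; rewrite /= modn_dvdm // -[in RHS]addn1 modnDml addn1.
pose h (f : coloring (cycle_graph g) l) : coloring (cycle_graph n) l :=
  [ffun v => f (p v)].
have h_inj : injective h.
  move=> f f' /ffunP E; apply/ffunP => w.
  by have := E (widen_ord g_le w); rewrite !ffunE p_widen.
rewrite /proper_count -(card_imset _ h_inj); apply: eq_card => f; rewrite inE.
apply/andP/imsetP => [[/proper_cycleP f_proper /eqP /ffunP f_fix]|[f' + ->]]; last first.
  rewrite inE => /proper_cycleP f'_proper; split.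
    by apply/proper_cycleP => i; rewrite !ffunE p_ordS.
  apply/eqP/ffunP => v; rewrite !ffunE permE; congr (f' _); apply: val_inj.
  by rewrite /= modn_dvdm // -modnDmr (eqP gm) addn0.
(* [F] is the [n]-periodic extension of [f] to all naturals, which frees the period arguments from
   bounds. *)
pose F k := f (Ordinal (ltn_pmod k n_gt0)).
have FE v : f v = F v by congr (f _); apply: val_inj; rewrite /= modn_small.
have Fn k q : F (k + q * n)%N = F k.
  by congr (f _); apply: val_inj; rewrite /= addnC modnMDl.
have Fm k q : F (k + q * m)%N = F k.
  elim: q => [|q IH]; first by rewrite addn0.
  rewrite -[RHS]IH [in RHS]/F f_fix ffunE permE; congr (f _); apply: val_inj.
  by rewrite /= modnDml mulSn (addnC m) addnA.
have Fg k : F (k + g)%N = F k.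
  (* Bezout without subtraction: [n] divides [g + a * m], so a shift by [g] followed by [a] shifts
     by [m] is trivial. *)
  have [a _ /dvdnP[q qE]] := Bezoutl m n_gt0.
  by rewrite -(Fm _ a) -addnA qE Fn.
have Fmod k : F (k %% g)%N = F k.
  rewrite {2}(divn_eq k g) addnC; elim: (k %/ g)%N => [|q IH]; first by rewrite addn0.
  by rewrite mulSn (addnC g) addnA Fg.
exists [ffun w => f (widen_ord g_le w)]; last first.
  by apply/ffunP => v; rewrite !ffunE !FE /= Fmod.
rewrite inE; apply/proper_cycleP => w; rewrite !ffunE.
have -> : f (widen_ord g_le (ordS w)) = f (ordS (widen_ord g_le w)).
  by rewrite !FE /= -[RHS]Fmod modn_dvdm.
exact: f_proper.
Qed.

Lemma OP_cycle_sum :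
  (OP (Rot n_gt0) l mu * n = \sum_(d <- divisors n) totient (n %/ d) * proper_count d l mu)%N.
Proof.
rewrite -[X in (_ * X)%N]card_Rot OP_burnside; last first.
  by move=> _ /imsetP[m _ ->] f; apply: proper_rotation.
rewrite (big_imset _ (in2W rotation_inj)) /=.
under eq_bigr do rewrite card_fixed_rotation.
rewrite (sum_gcdn (fun d => proper_count d l mu)) //.
by apply: eq_bigr => d _; rewrite -mulr_natr natn mulnC.
Qed.

End CycleRotations.

(** * The alternating contribution and the final formula *)

Lemma sum_sign_divisors (n : nat) : (0 < n)%N ->
  \sum_(d <- divisors n) (totient (n %/ d))%:R * (-1) ^+ d =
    (if odd n then - n%:R else 0) :> rat.
Proof.
move=> n_gt0.
(* Going back to a sum over residues: for odd [n] every gcd is odd, while for even [n] the gcd has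
   the parity of [m] and consecutive signs cancel. *)
transitivity (\sum_(m < n) (-1) ^+ gcdn n m : rat).
  by rewrite sum_gcdn //; apply: eq_bigr => d _; rewrite mulr_natl.
case: ifPn => [n_odd|n_even].
  rewrite (eq_bigr (fun=> -1)) ?sumr_const ?card_ord ?mulNrn // => m _.
  by rewrite -signr_odd (dvdn_odd (dvdn_gcdl n m)).
rewrite (eq_bigr (fun m : 'I_n => (-1) ^+ m)) => [|m _]; last first.
  rewrite -signr_odd -(signr_odd _ m); congr (_ ^+ nat_of_bool _).
  by apply: negb_inj; rewrite -!dvdn2 dvdn_gcd dvdn2 n_even.
have -> : n = n./2.*2 by rewrite even_halfK.
elim: n./2 => [|k IH]; first by rewrite big_ord0.
by rewrite doubleS !big_ord_recr /= IH exprS; ring.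
Qed.

Theorem theorem10 (n lambda mu : nat) (n_gt0 : (0 < n)%N)
    (lambda_gt0 : (0 < lambda)%N) (mu_le : (mu <= lambda)%N) :
  (odd n ->
     (OP (Rot n_gt0) lambda mu)%:R =
       n%:R^-1 * \sum_(d <- divisors n)
         (totient (n %/ d))%:R *
         (lucasV (lambda%:Z - 1) (mu%:Z - lambda%:Z) d)%:~R
       - mu%:R + 1 :> rat)
  /\
  (~~ odd n ->
     (OP (Rot n_gt0) lambda mu)%:R =
       n%:R^-1 * \sum_(d <- divisors n)
         (totient (n %/ d))%:R *
         (lucasV (lambda%:Z - 1) (mu%:Z - lambda%:Z) d)%:~R :> rat).
Proof.
set S := \sum_(d <- _) _.
have n_neq0 : n%:R != 0 :> rat by rewrite Num.Theory.pnatr_eq0 -lt0n.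
(* The term [(-1) ^+ d * (mu - 1)] of [proper_countE], summed with totient weights, gives the
   correction that depends on the parity of [n]. *)
have E : (OP (Rot n_gt0) lambda mu)%:R * n%:R =
    S + (if odd n then - n%:R else 0) * (mu%:R - 1) :> rat.
  rewrite -natrM OP_cycle_sum natr_sum -sum_sign_divisors // mulr_suml -big_split.
  apply: eq_big_seq => d; rewrite -dvdn_divisors // => /(dvdn_gt0 n_gt0) d_gt0 /=.
  have cE : ((-1) ^+ d * (mu%:Z - 1))%:~R = (-1) ^+ d * (mu%:R - 1) :> rat.
    by rewrite rmorphM rmorphB rmorphXn rmorphN1.
  have := congr1 (fun z : int => z%:~R : rat) (proper_countE mu_le d_gt0).
  rewrite rmorph_nat rmorphD /= cE natrM => ->.
  by ring.
split=> n_par; rewrite -[LHS](mulfK n_neq0) E ?n_par ?(negbTE n_par).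
  by field.
by rewrite mul0r addr0 mulrC.
Qed.
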